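(* Let $n,\ell\ge1$ and let $k=(k_1,\dots,k_\ell)$ be a partition of $n$. Every symbol on $\mathbb{P}^n(\mathbb{C})$ of the type $[w]\mapsto b(s_{(1)},\dots,s_{(\ell)})$ belongs to $\mu_n^*(L^\infty(D_n))$, where $D_n=\mu_n(\mathbb{P}^n(\mathbb{C}))$ is the Delzant polytope of the projective space $\mathbb{P}^n(\mathbb{C})$. More precisely, $$\{b(s_{(1)},\dots,s_{(\ell)}) : b\in L^\infty(S_+^{k_1-1}\times\dots\times S_+^{k_\ell-1})\}\subset\{f\circ\mu_n : f\in L^\infty(D_n)\}.$$
   Context: A partition of $n$ is $k=(k_1,\dots,k_\ell)$ with integers $k_j\ge1$, $k_1+\dots+k_\ell=n$. It decomposes $w\in\mathbb{C}^{n+1}$ as $w=(w_0,w_{(1)},\dots,w_{(\ell)})$ with $w_0\in\mathbb{C}$ and $w_{(j)}=(w_{j,1},\dots,w_{j,k_j})\in\mathbb{C}^{k_j}$ consecutive blocks. $S_+^{k_j-1}$ is the set of points of the unit sphere of $\mathbb{R}^{k_j}$ with nonnegative coordinates (with surface measure; counting measure on a point if $k_j=1$), and $$s_{(j)}=\frac{1}{|w_{(j)}|}(|w_{j,1}|,\dots,|w_{j,k_j}|)\in S_+^{k_j-1},\qquad j=1,\dots,\ell,$$ which is defined for a.e. $[w]$ and depends only on $[w]$. The torus $\mathbb{T}^n\simeq\{(t_0,\dots,t_n)\in\mathbb{T}^{n+1}:t_0\cdots t_n=1\}$ acts on $\mathbb{P}^n(\mathbb{C})$ by $t\cdot[w]=[t_0w_0,\dots,t_nw_n]$;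 this action is Hamiltonian for the Fubini–Study symplectic form, with moment map $$\mu_n:\mathbb{P}^n(\mathbb{C})\to\Big\{x\in\mathbb{R}^{n+1}:x_0+\dots+x_n=\tfrac12\Big\},\qquad\mu_n([w])=\frac{1}{2|w|^2}(|w_0|^2,\dots,|w_n|^2).$$ This formula is taken as the definition of $\mu_n$. $L^\infty(D_n)$ is with respect to $n$-dimensional Lebesgue measure on the affine hyperplane; functions are identified when equal almost everywhere. *)

(* Defs.v *)
From HB Require Import structures.
From mathcomp Require Import all_boot all_order all_algebra.
From mathcomp Require Import complex.
From mathcomp Require Import all_classical all_reals all_analysis.
From mathcomp Require Import measurable_realfun.

Set Implicit Arguments.
Unset Strict Implicit.
Unset Printing Implicit Defensive.

Import Order.TTheory GRing.Theory Num.Theory.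
Import numFieldNormedType.Exports.
Import ComplexField.Normc.

Local Open Scope classical_set_scope.
Local Open Scope ring_scope.
Local Open Scope complex_scope.
Local Open Scope quotient_scope.

Section image_sigma_algebra.
Context {d} {T : measurableType d} {U : Type}.
Variable f : T -> U.

Definition image_measurable : set (set U) :=
  image_set_system setT f (@measurable d T).

Lemma image_measurable0 : image_measurable set0.
Proof.
by rewrite /image_measurable /image_set_system /= preimage_set0 setI0.
Qed.

Lemma image_measurableC A : image_measurable A -> image_measurable (~` A).
Proof.
rewrite /image_measurable /image_set_system /= !setTI preimage_setC.
exact: measurableC.
Qed.

Lemma image_measurable_bigcup (F : (set U)^nat) :
  (forall i, image_measurable (F i)) -> image_measurable (\bigcup_i F i).
Proof.
rewrite /image_measurable /image_set_system /= => mF.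
rewrite setTI preimage_bigcup; apply: bigcup_measurable => i _.
by have := mF i; rewrite setTI.
Qed.

End image_sigma_algebra.

(* The canonical sigma-finite structure of the library's \x is only found for
   products of subprobabilities; this alias carries it in general. *)
Definition sf_prod d1 d2 (T1 : measurableType d1) (T2 : measurableType d2)
    (R : realType) (m1 : {sigma_finite_measure set T1 -> \bar R})
    (m2 : {sigma_finite_measure set T2 -> \bar R}) : set (T1 * T2) -> \bar R :=
  (m1 \x m2)%E.

Section sf_prod.
Context d1 d2 (T1 : measurableType d1) (T2 : measurableType d2) (R : realType).
Variables (m1 : {sigma_finite_measure set T1 -> \bar R}).
Variables (m2 : {sigma_finite_measure set T2 -> \bar R}).

HB.instance Definition _ := Measure.copy (sf_prod m1 m2) (m1 \x m2)%E.

Let sf_prod_sigma_finite : sigma_finite [set: T1 * T2] (sf_prod m1 m2).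
Proof.
have /sigma_finiteP[F [UF ndF mF]] := sigma_finiteT m1.
have /sigma_finiteP[G [UG ndG mG]] := sigma_finiteT m2.
exists (fun n => F n `*` G n).
  apply/seteqP; split=> -[x y] // _.
  have [i _ Fx] : (\bigcup_i F i) x by rewrite -UF.
  have [j _ Gy] : (\bigcup_i G i) y by rewrite -UG.
  exists (maxn i j) => //; split.
    by move: x Fx {Gy}; exact/subsetPset/ndF/leq_maxl.
  by move: y Gy {Fx}; exact/subsetPset/ndG/leq_maxr.
move=> i; have [mFi Fioo] := mF i; have [mGi Gioo] := mG i.
split; first exact: measurableX.
by rewrite /sf_prod product_measure1E// lte_mul_pinfty// ge0_fin_numE.
Qed.

HB.instance Definition _ := Measure_isSigmaFinite.Build _ _ _
  (sf_prod m1 m2) sf_prod_sigma_finite.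

End sf_prod.

(* The push-forward of m along f, keyed by proofs that f is an embedding of
   measurable spaces, so that it is canonically a sigma-finite measure. *)
Definition embed_pushforward d d' (T : measurableType d) (U : measurableType d')
    (R : realType) (m : set T -> \bar R) (f : T -> U) (g : U -> T)
    (mf : measurable_fun [set: T] f) (mg : measurable_fun [set: U] g)
    (fK : cancel f g) : set U -> \bar R := pushforward m f.

Section embed_pushforward.
Context d d' (T : measurableType d) (U : measurableType d') (R : realType).
Variables (m : {sigma_finite_measure set T -> \bar R}) (f : T -> U) (g : U -> T).
Variables (mf : measurable_fun [set: T] f) (mg : measurable_fun [set: U] g).
Variable fK : cancel f g.

Let mu : {measure set U -> \bar R} :=
  measure_function_pushforward__canonical__measure_function_Measure m mf.

HB.instance Definition _ := isMeasure.Build _ _ _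
  (embed_pushforward m mf mg fK) (measure0 mu) (measure_ge0 mu)
  (@measure_semi_sigma_additive _ _ _ mu).

Let embed_pushforward_sigma_finite :
  sigma_finite [set: U] (embed_pushforward m mf mg fK).
Proof.
have [F UF mF] := sigma_finiteT m.
exists (fun i => g @^-1` F i); first by rewrite -preimage_bigcup -UF.
move=> i; have [mFi Fioo] := mF i; split.
  by rewrite -[X in measurable X]setTI; exact: mg.
rewrite /embed_pushforward /pushforward (_ : f @^-1` _ = F i)//.
by apply/seteqP; split=> x /=; rewrite fK.
Qed.

HB.instance Definition _ := Measure_isSigmaFinite.Build _ _ _
  (embed_pushforward m mf mg fK) embed_pushforward_sigma_finite.

End embed_pushforward.

(* The product of n copies of mu. *)
Fixpoint tuple_measure d (T : measurableType d) (R : realType)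
    (mu : set T -> \bar R) (n : nat) : set (n.-tuple T) -> \bar R :=
  match n return set (n.-tuple T) -> \bar R with
  | 0%N => \d_[tuple]
  | n'.+1 => pushforward (mu \x @tuple_measure d T R mu n')%E
               (fun p : T * n'.-tuple T => [tuple of p.1 :: p.2])
  end.
Arguments tuple_measure {d T R} mu n.

Section tuple_measure.
Context d (T : measurableType d) (R : realType).
Variable mu : {sigma_finite_measure set T -> \bar R}.

Let tuple_measureE n :
  {m : {sigma_finite_measure set (n.-tuple T) -> \bar R} |
    m = tuple_measure mu n :> (set (n.-tuple T) -> \bar R)}.
Proof.
elim: n => [|n [m mE]] /=; first by exists \d_[tuple].
have mf : measurable_fun [set: T * n.-tuple T]
    (fun p : T * n.-tuple T => [tuple of p.1 :: p.2]).
  exact: measurable_cons.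
have mg : measurable_fun [set: n.+1.-tuple T]
    (fun t : n.+1.-tuple T => (thead t, [tuple of behead t])).
  by apply/measurable_fun_pairP; split;
    [exact: measurable_tnth|exact: measurable_behead].
rewrite -mE.
have fK : cancel (fun p : T * n.-tuple T => [tuple of p.1 :: p.2])
    (fun t : n.+1.-tuple T => (thead t, [tuple of behead t])).
  by case=> x t; congr pair => //=; apply/val_inj.
by exists (embed_pushforward (sf_prod mu m) mf mg fK).
Qed.

Let tuple_measure0 n : tuple_measure mu n set0 = 0%E.
Proof. by case: (tuple_measureE n) => m <-; exact: measure0. Qed.

Let tuple_measure_ge0 n A : (0 <= tuple_measure mu n A)%E.
Proof. by case: (tuple_measureE n) => m <-; exact: measure_ge0. Qed.

Let tuple_measure_sigma_additive n : semi_sigma_additive (tuple_measure mu n).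
Proof.
by case: (tuple_measureE n) => m <-; exact: measure_semi_sigma_additive.
Qed.

HB.instance Definition _ n := isMeasure.Build _ _ _ (tuple_measure mu n)
  (tuple_measure0 n) (@tuple_measure_ge0 n) (@tuple_measure_sigma_additive n).

Let tuple_measure_sigma_finite n : sigma_finite setT (tuple_measure mu n).
Proof. by case: (tuple_measureE n) => m <-; exact: sigma_finiteT. Qed.

HB.instance Definition _ n := Measure_isSigmaFinite.Build _ _ _
  (tuple_measure mu n) (tuple_measure_sigma_finite n).

End tuple_measure.

(* lebesgue_measure lives on measurableTypeR R, whose measurable structure has
   another display than the canonical one of R (the sigma-algebras agree). *)
Definition lebesgueR (R : realType) : set R -> \bar R := @lebesgue_measure R.

Section lebesgueR.
Variable R : realType.

HB.instance Definition _ := isMeasure.Build _ _ _ (@lebesgueR R)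
  (measure0 (@lebesgue_measure R)) (measure_ge0 (@lebesgue_measure R))
  (@measure_semi_sigma_additive _ _ _ (@lebesgue_measure R)).
HB.instance Definition _ := Measure_isSigmaFinite.Build _ _ _ (@lebesgueR R)
  (sigma_finiteT (@lebesgue_measure R)).

End lebesgueR.

Section complex_measurable.
Variable R : realType.

(* R[i] = R^2 carries the Borel sigma-algebra and Lebesgue measure of R^2. *)
Definition complex_of_pair (p : R * R) : R[i] := p.1 +i* p.2.

HB.instance Definition _ := isPointed.Build R[i] 0.

HB.instance Definition _ := @isMeasurable.Build default_measure_display R[i]
  (image_measurable complex_of_pair) (image_measurable0 _)
  (@image_measurableC _ _ _ _) (@image_measurable_bigcup _ _ _ _).

Definition complex_lebesgue : set R[i] -> \bar R :=
  pushforward (@lebesgueR R \x @lebesgueR R)%E complex_of_pair.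

Let pair_of_complex (z : R[i]) : R * R := (complex.Re z, complex.Im z).

Let complex_of_pairK : cancel complex_of_pair pair_of_complex.
Proof. by case. Qed.

Let measurable_complex_of_pair : measurable_fun [set: R * R] complex_of_pair.
Proof. by move=> _ A; rewrite /measurable /=. Qed.

Let measurable_pair_of_complex : measurable_fun [set: R[i]] pair_of_complex.
Proof.
move=> _ A mA; rewrite setTI /measurable /= /image_measurable.
rewrite /image_set_system /= setTI -comp_preimage.
rewrite (_ : _ @^-1` A = A)//.
by apply/seteqP; split=> x /=; rewrite complex_of_pairK.
Qed.

Lemma measurable_Re : measurable_fun [set: R[i]] (@complex.Re R).
Proof.
have -> : @complex.Re R = fst \o pair_of_complex by [].
exact: measurableT_comp.
Qed.

Lemma measurable_Im : measurable_fun [set: R[i]] (@complex.Im R).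
Proof.
have -> : @complex.Im R = snd \o pair_of_complex by [].
exact: measurableT_comp.
Qed.

Let m : {sigma_finite_measure set R[i] -> \bar R} :=
  embed_pushforward (sf_prod (@lebesgueR R) (@lebesgueR R))
    measurable_complex_of_pair measurable_pair_of_complex complex_of_pairK.

HB.instance Definition _ := isMeasure.Build _ _ _ complex_lebesgue
  (measure0 m) (measure_ge0 m) (@measure_semi_sigma_additive _ _ _ m).
HB.instance Definition _ := Measure_isSigmaFinite.Build _ _ _ complex_lebesgue
  (sigma_finiteT m).

Lemma measurable_normc : measurable_fun [set: R[i]] (@normc R).
Proof.
have -> : @normc R = fun z =>
    (complex.Re z ^+ 2 + complex.Im z ^+ 2) `^ 2^-1.
  by apply/funext => -[x y] /=; rewrite powR12_sqrt// addr_ge0// sqr_ge0.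
apply: (@measurableT_comp _ _ _ _ _ _ (@powR R ^~ 2^-1)) => //.
by apply: measurable_funD; apply: measurable_funX;
  [exact: measurable_Re|exact: measurable_Im].
Qed.

End complex_measurable.

Section euclidean.
Variable R : realType.
Implicit Types k n : nat.

Definition euclid_norm k (x : k.-tuple R) : R :=
  Num.sqrt (\sum_(i < k) tnth x i ^+ 2).

Definition normalize k (x : k.-tuple R) : k.-tuple R :=
  [tuple tnth x i / euclid_norm x | i < k].

(* S_+^{k-1}, as a subset of R^k. *)
Definition sphere_plus k : set (k.-tuple R) :=
  [set x | euclid_norm x = 1 /\ forall i, 0 <= tnth x i].

Definition lebesgue_tuple k : set (k.-tuple R) -> \bar R :=
  tuple_measure (@lebesgueR R) k.

HB.instance Definition _ k := SigmaFiniteMeasure.copy (@lebesgue_tuple k)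
  (tuple_measure (@lebesgueR R) k).

Definition punctured_ball k : set (k.-tuple R) :=
  [set y | 0 < euclid_norm y <= 1].

(* The surface measure of S^{k-1}: k times the Lebesgue measure of the cone
   with apex 0 over A. For k = 1 it is the counting measure on {-1, 1}. *)
Definition sphere_measure k (A : set (k.-tuple R)) : \bar R :=
  (k%:R%:E * lebesgue_tuple ((@normalize k @^-1` A) `&` @punctured_ball k))%E.

Definition sphere_plus_measure k (A : set (k.-tuple R)) : \bar R :=
  sphere_measure (A `&` @sphere_plus k).

Lemma measurable_euclid_norm k : measurable_fun [set: k.-tuple R] (@euclid_norm k).
Proof.
have -> : @euclid_norm k = (@powR R ^~ 2^-1) \o
    (fun x => \sum_(i < k) tnth x i ^+ 2).
  apply/funext => x /=; rewrite powR12_sqrt//.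
  by apply: sumr_ge0 => i _; exact: sqr_ge0.
apply: (@measurableT_comp _ _ _ _ _ _ (@powR R ^~ 2^-1)) => //.
apply: measurable_sum => i; apply: measurable_funX.
exact: measurable_tnth.
Qed.

Lemma measurable_normalize k : measurable_fun [set: k.-tuple R] (@normalize k).
Proof.
apply/measurable_fun_tnthP => i.
have -> : (@tnth _ _)^~ i \o @normalize k =
    (fun x => tnth x i * (euclid_norm x `^ -1)).
  by apply/funext => x /=; rewrite tnth_mktuple powR_inv1// sqrtr_ge0.
apply: measurable_funM; first exact: measurable_tnth.
apply: (@measurableT_comp _ _ _ _ _ _ (@powR R ^~ (-1))) => //.
exact: measurable_euclid_norm.
Qed.

Let measurable_punctured_ball k : measurable (@punctured_ball k).
Proof.
rewrite (_ : @punctured_ball k = @euclid_norm k @^-1` `]0, 1]).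
  rewrite -[X in measurable X]setTI; apply: measurable_euclid_norm => //.
by apply/seteqP; split=> x /=; rewrite in_itv.
Qed.

Let measurable_sphere_plus k : measurable (@sphere_plus k).
Proof.
rewrite (_ : @sphere_plus k = @euclid_norm k @^-1` [set 1] `&`
    \bigcap_(i in [set: 'I_k]) ((fun x => tnth x i) @^-1` `[0, +oo[)).
  apply: measurableI.
    by rewrite -[X in measurable X]setTI; exact: measurable_euclid_norm.
  apply: fin_bigcap_measurable => // i _.
  by rewrite -[X in measurable X]setTI; exact: measurable_tnth.
apply/seteqP; split=> x /= [x1 x0]; split => // i.
  by move=> _; rewrite /= in_itv/= andbT.
by have := x0 i I; rewrite /= in_itv/= andbT.
Qed.

Let lebesgue_box k :
  (lebesgue_tuple [set y : k.-tuple R | forall i, (tnth y i \in `[-1, 1])%R] < +oo)%E.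
Proof.
elim: k => [|k IH]; first by rewrite /lebesgue_tuple /= diracE ltry.
set B := (X in lebesgue_tuple X) in IH; set J : set R := `[-1, 1]%classic.
rewrite /lebesgue_tuple /= /pushforward.
rewrite (_ : _ @^-1` _ = J `*` B); last first.
  apply/seteqP; split=> -[x y] /=.
    move=> xy; split; first exact: (xy ord0).
    by move=> i; have := xy (lift ord0 i); rewrite tnthS.
  by move=> [x1 y1] i; case: (unliftP ord0 i) => [j|] ->; rewrite ?tnthS.
have mB : measurable B.
  rewrite (_ : B = \bigcap_(i in [set: 'I_k])
      ((fun x => tnth x i) @^-1` `[-1, 1])).
    apply: fin_bigcap_measurable => // i _.
    by rewrite -[X in measurable X]setTI; exact: measurable_tnth.
  by apply/seteqP; split=> x /= xB i //; [move=> _|]; exact: xB.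
have -> : (@lebesgueR R \x tuple_measure (@lebesgueR R) k)%E (J `*` B) =
    (lebesgueR J * lebesgue_tuple B)%E.
  apply: (@product_measure1E _ _ _ _ _ (@lebesgueR R) (@lebesgue_tuple k)) => //.
  exact: measurable_itv.
rewrite lte_mul_pinfty//.
  rewrite ge0_fin_numE// /lebesgueR /= lebesgue_measure_itv/=.
  by case: ifP => _; rewrite ?ltry.
Qed.

Let lebesgue_punctured_ball k : (lebesgue_tuple (@punctured_ball k) < +oo)%E.
Proof.
apply: le_lt_trans (lebesgue_box k); apply: le_measure; rewrite ?inE//.
  rewrite (_ : mkset _ = \bigcap_(i in [set: 'I_k])
      ((fun x => tnth x i) @^-1` `[-1, 1])).
    apply: fin_bigcap_measurable => // i _.
    by rewrite -[X in measurable X]setTI; exact: measurable_tnth.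
  by apply/seteqP; split=> x /= xB i //; [move=> _|]; exact: xB.
move=> y /= /andP[_ y1] i; rewrite in_itv/= -ler_norml -sqrtr_sqr.
apply: le_trans y1; rewrite ler_sqrt; last first.
  by apply: sumr_ge0 => j _; exact: sqr_ge0.
by rewrite (bigD1 i)//= lerDl; apply: sumr_ge0 => j _; exact: sqr_ge0.
Qed.

Section sphere_measure.
Variable k : nat.

Let cone : {measure set (k.-tuple R) -> \bar R} :=
  mrestr (@lebesgue_tuple k) (@measurable_punctured_ball k).

Let push : {measure set (k.-tuple R) -> \bar R} :=
  measure_function_pushforward__canonical__measure_function_Measure cone
    (@measurable_normalize k).

Let sph : {measure set (k.-tuple R) -> \bar R} := mscale k%:R%:nng push.

HB.instance Definition _ := isMeasure.Build _ _ _ (@sphere_measure k)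
  (measure0 sph) (measure_ge0 sph) (@measure_semi_sigma_additive _ _ _ sph).

Let sphp : {measure set (k.-tuple R) -> \bar R} :=
  mrestr (@sphere_measure k) (@measurable_sphere_plus k).

HB.instance Definition _ := isMeasure.Build _ _ _ (@sphere_plus_measure k)
  (measure0 sphp) (measure_ge0 sphp) (@measure_semi_sigma_additive _ _ _ sphp).

Let sphere_plus_measure_fin : fin_num_fun (@sphere_plus_measure k).
Proof.
move=> A mA; rewrite ge0_fin_numE//.
rewrite /sphere_plus_measure /sphere_measure lte_mul_pinfty//.
apply: le_lt_trans (lebesgue_punctured_ball k); apply: le_measure;
  rewrite ?inE//.
apply: measurableI => //; rewrite -[X in measurable X]setTI.
apply: measurable_normalize => //; apply: measurableI => //.
exact: measurable_sphere_plus.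
Qed.

HB.instance Definition _ := Measure_isFinite.Build _ _ _ (@sphere_plus_measure k)
  sphere_plus_measure_fin.

End sphere_measure.

End euclidean.

Section blocks.
Variable R : realType.

(* R^{k_1} * (R^{k_2} * ( ... * unit)), with its product sigma-algebra. *)
Fixpoint blocks_sig (k : seq nat) : {d : measure_display & measurableType d} :=
  match k with
  | [::] => existT (fun d => measurableType d) _ unit
  | k1 :: k' => existT (fun d => measurableType d) _
      (k1.-tuple R * projT2 (blocks_sig k'))%type
  end.

Definition blocks (k : seq nat) : measurableType _ := projT2 (blocks_sig k).

(* S_+^{k_1-1} * ... * S_+^{k_l-1} and its product measure. *)
Fixpoint spheres_plus (k : seq nat) : set (blocks k) :=
  match k return set (blocks k) with
  | [::] => [set: unit]
  | k1 :: k' => @sphere_plus R k1 `*` @spheres_plus k'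
  end.

Fixpoint spheres_plus_measure (k : seq nat) : set (blocks k) -> \bar R :=
  match k return set (blocks k) -> \bar R with
  | [::] => \d_tt
  | k1 :: k' => (@sphere_plus_measure R k1 \x @spheres_plus_measure k')%E
  end.

(* (s_(1), ..., s_(l)) for the vector (w_(1), ..., w_(l)) listed as a sequence
   of length k_1 + ... + k_l. *)
Fixpoint spherical_blocks (k : seq nat) (v : seq R[i]) : blocks k :=
  match k return blocks k with
  | [::] => tt
  | k1 :: k' => (normalize [tuple normc v`_i | i < k1],
                 spherical_blocks k' (drop k1 v))
  end.

Let spheres_plus_measureE k :
  {m : {sigma_finite_measure set (blocks k) -> \bar R} |
    m = @spheres_plus_measure k :> (set (blocks k) -> \bar R)}.
Proof.
elim: k => [|k1 k [m mE]] /=; first by exists \d_tt.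
exists (sf_prod (@sphere_plus_measure R k1) m).
exact: (congr1 (product_measure1 (@sphere_plus_measure R k1)) mE).
Qed.

Let spheres_plus_measure0 k : @spheres_plus_measure k set0 = 0%E.
Proof. by case: (spheres_plus_measureE k) => m <-; exact: measure0. Qed.

Let spheres_plus_measure_ge0 k A : (0 <= @spheres_plus_measure k A)%E.
Proof. by case: (spheres_plus_measureE k) => m <-; exact: measure_ge0. Qed.

Let spheres_plus_measure_sigma_additive k :
  semi_sigma_additive (@spheres_plus_measure k).
Proof.
by case: (spheres_plus_measureE k) => m <-; exact: measure_semi_sigma_additive.
Qed.

HB.instance Definition _ k := isMeasure.Build _ _ _ (@spheres_plus_measure k)
  (spheres_plus_measure0 k) (@spheres_plus_measure_ge0 k)
  (@spheres_plus_measure_sigma_additive k).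

Let spheres_plus_measure_sigma_finite k :
  sigma_finite setT (@spheres_plus_measure k).
Proof. by case: (spheres_plus_measureE k) => m <-; exact: sigma_finiteT. Qed.

HB.instance Definition _ k := Measure_isSigmaFinite.Build _ _ _
  (@spheres_plus_measure k) (spheres_plus_measure_sigma_finite k).

End blocks.

Section projective_space.
Variables (R : realType) (n : nat).
Local Notation vec := (n.+1.-tuple R[i]).

Definition nonzero_vec := {w : vec | w != [tuple 0 | _ < n.+1]}.

HB.instance Definition _ := Choice.on nonzero_vec.
HB.instance Definition _ := SubType.on nonzero_vec.

Definition collinear (v w : nonzero_vec) : bool :=
  `[< exists2 c : R[i], c != 0 &
      forall i, tnth (val w) i = c * tnth (val v) i >].

Lemma collinear_refl : reflexive collinear.
Proof.
by move=> v; apply/asboolP; exists 1; rewrite ?oner_neq0// => i; rewrite mul1r.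
Qed.

Lemma collinear_sym : symmetric collinear.
Proof.
suff sym v w : collinear v w -> collinear w v.
  by move=> v w; apply/idP/idP; exact: sym.
move=> /asboolP[c c0 vw]; apply/asboolP; exists c^-1; first by rewrite invr_eq0.
by move=> i; rewrite vw mulKf.
Qed.

Lemma collinear_trans : transitive collinear.
Proof.
move=> v u w /asboolP[c c0 uv] /asboolP[d d0 vw]; apply/asboolP.
by exists (d * c); [rewrite mulf_neq0|move=> i; rewrite vw uv mulrA].
Qed.

Canonical collinear_equiv :=
  EquivRel collinear collinear_refl collinear_sym collinear_trans.

Definition proj_space := {eq_quot collinear}.

HB.instance Definition _ := EqQuotient.on proj_space.
HB.instance Definition _ := Choice.on proj_space.

Lemma ones_neq0 : [tuple 1 : R[i] | _ < n.+1] != [tuple 0 | _ < n.+1].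
Proof.
apply/eqP => /(congr1 (fun w : vec => tnth w ord0)).
by rewrite !tnth_mktuple => /eqP; rewrite oner_eq0.
Qed.

Definition ones : nonzero_vec :=
  exist (fun w : vec => w != [tuple 0 | _ < n.+1]) _ ones_neq0.

(* [w], with the junk value [1 : ... : 1] at w = 0. *)
Definition proj_class (w : vec) : proj_space :=
  \pi_proj_space (insubd ones w).

HB.instance Definition _ := isPointed.Build proj_space
  (proj_class [tuple 1 | _ < n.+1]).

(* As {0} is a Borel set, this is the quotient sigma-algebra of C^{n+1} \ {0},
   i.e. the Borel sigma-algebra of P^n(C). *)
HB.instance Definition _ := @isMeasurable.Build default_measure_display
  proj_space (image_measurable proj_class) (image_measurable0 _)
  (@image_measurableC _ _ _ _) (@image_measurable_bigcup _ _ _ _).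

Definition hermitian_norm (w : vec) : R :=
  Num.sqrt (\sum_(i < n.+1) normc (tnth w i) ^+ 2).

Definition lebesgue_complex_tuple : set vec -> \bar R :=
  tuple_measure (@complex_lebesgue R) n.+1.

Definition punctured_hball : set vec := [set w | 0 < hermitian_norm w <= 1].

(* The Fubini-Study volume: the U(n+1)-invariant measure of total mass
   pi^n / n!, obtained from Lebesgue measure on the unit ball of C^{n+1}. *)
Definition fubini_study (A : set proj_space) : \bar R :=
  ((n.+1%:R / pi)%:E *
   lebesgue_complex_tuple (proj_class @^-1` A `&` punctured_hball))%E.

Definition moment_coord (w : vec) : n.+1.-tuple R :=
  [tuple normc (tnth w i) ^+ 2 / (2 * hermitian_norm w ^+ 2) | i < n.+1].

Definition moment_map (p : proj_space) : n.+1.-tuple R :=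
  moment_coord (val (repr p)).

(* The map [w] |-> (s_(1), ..., s_(l)), where w = (w_0, w_(1), ..., w_(l)). *)
Definition spherical_coords (k : seq nat) (p : proj_space) : blocks R k :=
  spherical_blocks k (behead (val (repr p))).

Definition polytope : set (n.+1.-tuple R) := range moment_map.

Definition hyperplane_chart (x : n.-tuple R) : n.+1.-tuple R :=
  [tuple of 2^-1 - \sum_(i < n) tnth x i :: x].

(* n-dimensional Lebesgue measure on the hyperplane x_0 + ... + x_n = 1/2,
   parametrized by (x_1, ..., x_n); the volume factor of this chart is
   sqrt (n + 1). *)
Definition hyperplane_measure (A : set (n.+1.-tuple R)) : \bar R :=
  ((Num.sqrt n.+1%:R)%:E * @lebesgue_tuple R n
     (hyperplane_chart @^-1` A))%E.

Let measurable_proj_class : measurable_fun [set: vec] proj_class.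
Proof. by move=> _ A; rewrite /measurable /=. Qed.

Let measurable_punctured_hball :
  measurable punctured_hball.
Proof.
have mh : measurable_fun [set: vec] hermitian_norm.
  have -> : hermitian_norm = (@powR R ^~ 2^-1) \o
      (fun w => \sum_(i < n.+1) normc (tnth w i) ^+ 2).
    apply/funext => x /=; rewrite powR12_sqrt//.
    by apply: sumr_ge0 => i _; exact: sqr_ge0.
  apply: (@measurableT_comp _ _ _ _ _ _ (@powR R ^~ 2^-1)) => //.
  apply: measurable_sum => i; apply: measurable_funX.
  apply: (@measurableT_comp _ _ _ _ _ _ (@normc R)).
    exact: measurable_normc.
  exact: measurable_tnth.
rewrite (_ : punctured_hball = hermitian_norm @^-1` `]0, 1]).
  by rewrite -[X in measurable X]setTI; apply: mh.
by apply/seteqP; split=> x /=; rewrite in_itv.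
Qed.

Let cone : {measure set vec -> \bar R} :=
  mrestr (tuple_measure (@complex_lebesgue R) n.+1) measurable_punctured_hball.

Let fs_factor_ge0 : 0 <= n.+1%:R / pi :> R.
Proof. by rewrite divr_ge0// pi_ge0. Qed.

Let fs : {measure set proj_space -> \bar R} := mscale (NngNum fs_factor_ge0)
  (measure_function_pushforward__canonical__measure_function_Measure cone
    measurable_proj_class).

HB.instance Definition _ := isMeasure.Build _ _ _ fubini_study
  (measure0 fs) (measure_ge0 fs) (@measure_semi_sigma_additive _ _ _ fs).

Let measurable_chart : measurable_fun [set: n.-tuple R] hyperplane_chart.
Proof.
apply: measurable_cons => //; apply: measurable_funB => //.
by apply: measurable_sum => i; exact: measurable_tnth.
Qed.

Let hm : {measure set (n.+1.-tuple R) -> \bar R} :=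
  mscale (NngNum (sqrtr_ge0 (n.+1%:R : R)))
  (measure_function_pushforward__canonical__measure_function_Measure
    (@lebesgue_tuple R n) measurable_chart).

HB.instance Definition _ := isMeasure.Build _ _ _ hyperplane_measure
  (measure0 hm) (measure_ge0 hm) (@measure_semi_sigma_additive _ _ _ hm).

Lemma proj_classP (w : vec) : w != [tuple 0 | _ < n.+1] ->
  exists2 c : R[i], c != 0 &
    forall i, tnth (val (repr (proj_class w))) i = c * tnth w i.
Proof.
move=> w0; pose v : nonzero_vec := exist (fun w : vec => w != [tuple 0 | _ < n.+1]) w w0.
have -> : proj_class w = \pi_proj_space v.
  by rewrite /proj_class; congr (\pi_proj_space _); apply/val_inj;
    rewrite val_insubd w0.
have : v = repr (\pi_proj_space v) %[mod proj_space] by rewrite reprK.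
by move/eqmodP => /= /asboolP[c c0 vE]; exists c.
Qed.

Lemma moment_map_class (w : vec) : w != [tuple 0 | _ < n.+1] ->
  moment_map (proj_class w) = moment_coord w.
Proof.
move=> /proj_classP[c c0 wE].
rewrite /moment_map; set v := val _ in wE *.
have nc0 : normc c != 0 by apply: contra c0 => /eqP/eq0_normc ->.
have nc_ge0 : 0 <= normc c by case: (c) => x y; exact: sqrtr_ge0.
have vE : hermitian_norm v = normc c * hermitian_norm w.
  rewrite /hermitian_norm; under eq_bigr do rewrite wE normcM exprMn.
  by rewrite -mulr_sumr sqrtrM ?sqr_ge0// sqrtr_sqr ger0_norm.
apply: eq_from_tnth => i; rewrite !tnth_mktuple vE wE normcM !exprMn.
by rewrite [X in _ / X]mulrCA -mulf_div divff ?mul1r// expf_neq0.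
Qed.

Lemma spherical_coords_class (k : seq nat) (w : vec) :
  w != [tuple 0 | _ < n.+1] ->
  spherical_coords k (proj_class w) = spherical_blocks k (behead w).
Proof.
move=> /proj_classP[c c0 wE].
rewrite /spherical_coords; set v := val _ in wE *.
have nc0 : normc c != 0 by apply: contra c0 => /eqP/eq0_normc ->.
have nc_ge0 : 0 <= normc c by case: (c) => x y; exact: sqrtr_ge0.
have {wE} : forall i, (behead v)`_i = c * (behead w)`_i.
  move=> i; rewrite !nth_behead; case: (ltnP i.+1 n.+1) => [ni|ni].
    by have := wE (Ordinal ni); rewrite !(tnth_nth 0).
  by rewrite !nth_default ?size_tuple// mulr0.
elim: k (behead v) (behead w) => //= k1 k IH {}v {}w vw.
congr pair; last by apply: IH => i; rewrite !nth_drop.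
set x := [tuple _ | i < k1]; set y := [tuple _ | i < k1].
have xE i : tnth x i = normc c * tnth y i by rewrite !tnth_mktuple vw normcM.
have nE : euclid_norm x = normc c * euclid_norm y.
  rewrite /euclid_norm; under eq_bigr do rewrite xE exprMn.
  by rewrite -mulr_sumr sqrtrM ?sqr_ge0// sqrtr_sqr ger0_norm.
apply: eq_from_tnth => i; rewrite [LHS]tnth_mktuple [RHS]tnth_mktuple xE nE.
by rewrite -mulf_div divff// mul1r.
Qed.

End projective_space.

Section Linfty.
Context d (T : measurableType d) (R : realType).

(* The representatives of the elements of the complex L^oo (D, mu). *)
Definition Linfty (mu : set T -> \bar R) (D : set T) : set (T -> R[i]) :=
  [set f | measurable_fun D f /\
     exists M : R, {ae mu, forall x, D x -> normc (f x) <= M}].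

Definition ae_class (mu : set T -> \bar R) (f : T -> R[i]) : set (T -> R[i]) :=
  [set g | {ae mu, forall x, g x = f x}].

End Linfty.

Definition is_partition (n l : nat) (k : l.-tuple nat) : Prop :=
  (forall j, (1 <= tnth k j)%N) /\ (\sum_(j < l) tnth k j)%N = n.

(* Main.v *)
(* The coordinates of the moment map are |w_i|^2 / (2 |w|^2), so the square roots
   of their absolute values are the moduli |w_i| up to a common positive factor,
   and each s_(j) is the normalized j-th block of these square roots. This
   factors [w] |-> b (s_(1), ..., s_(l)) through the moment map wherever no
   coordinate of w vanishes, i.e. almost everywhere.
   The factor is essentially bounded because the map from R^n to the product of
   spheres pulls null sets back to null sets. That property ("nonsingular") is
   stable under composition and, by Tonelli, under products; this reduces it to
   x |-> sqrt |x| on R, which has a locally Lipschitz inverse, and to x |-> x/|x|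
   on R^k, for which it follows by scaling from the definition of the surface
   measure as a cone measure. *)
Require Import Defs.
From mathcomp Require Import all_boot all_order all_algebra.
From mathcomp Require Import complex.
From mathcomp Require Import all_classical all_reals all_analysis.
From mathcomp Require Import measurable_realfun.
From mathcomp Require Import ring lra.

Import numFieldNormedType.Exports.
Local Open Scope classical_set_scope.

Set Implicit Arguments.
Unset Strict Implicit.
Unset Printing Implicit Defensive.

Import Order.TTheory GRing.Theory Num.Theory.
Import ComplexField.Normc.
Local Open Scope ring_scope.

(** * Null sets, and null sets of product measures *)

Lemma measure_eq0_subset d (T : measurableType d) (R : realType)
    (m : {measure set T -> \bar R}) (A B : set T) :
  measurable A -> measurable B -> A `<=` B -> m B = 0%E -> m A = 0%E.
Proof.
move=> mA mB AB mB0; apply/eqP; rewrite -measure_le0 -mB0.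
by apply: le_measure; rewrite ?inE.
Qed.

Lemma measure_setU_eq0 d (T : measurableType d) (R : realType)
    (m : {measure set T -> \bar R}) (A B : set T) :
  measurable A -> measurable B -> m A = 0%E -> m B = 0%E ->
  m (A `|` B) = 0%E.
Proof.
move=> mA mB A0 B0; apply/eqP; rewrite -measure_le0.
have : (m (A `|` B) <= m A + m B)%E by exact: measureU2.
by rewrite A0 B0 adde0.
Qed.

Lemma measure_bigcup_eq0 d (T : measurableType d) (R : realType)
    (m : {measure set T -> \bar R}) (F : (set T)^nat) :
  (forall i, measurable (F i)) -> (forall i, m (F i) = 0%E) ->
  m (\bigcup_i F i) = 0%E.
Proof.
move=> mF F0; apply: (@measure_negligible _ _ _ m).
  exact: bigcup_measurable.
apply: negligible_bigcup => i; by exists (F i); split.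
Qed.

Section product_null.
Context d1 d2 (T1 : measurableType d1) (T2 : measurableType d2) (R : realType).
Variables (m1 : {measure set T1 -> \bar R}).
Variables (m2 : {sigma_finite_measure set T2 -> \bar R}).

Lemma measurable_xsection_neq0 (A : set (T1 * T2)) : measurable A ->
  measurable [set x | m2 (xsection A x) != 0%E].
Proof.
move=> mA; rewrite -[X in measurable X]setTI.
by apply: emeasurable_neq => //; exact: measurable_fun_xsection.
Qed.

(** Tonelli: the product measure of [A] is the integral over x of the measure of its section at x,
    and the integral of a nonnegative function vanishes exactly when the function is zero almost
    everywhere. *)
Lemma product_null_setP (A : set (T1 * T2)) : measurable A ->
  (m1 \x m2)%E A = 0%E <-> m1 [set x | m2 (xsection A x) != 0%E] = 0%E.
Proof.
move=> mA.
have := ae_eq_integral_abs m1 measurableT (measurable_fun_xsection m2 mA).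
rewrite (eq_integral (m2 \o xsection A)); last first.
  by move=> x _; rewrite gee0_abs.
move=> iP; split=> [/iP A0|A0].
  apply: (@measure_negligible _ _ _ m1); first exact: measurable_xsection_neq0.
  case: A0 => N [mN N0 AN]; exists N; split=> // x /= /eqP Ax.
  by apply: AN => /= /(_ I).
apply/iP; exists [set x | m2 (xsection A x) != 0%E]; split => //.
  exact: measurable_xsection_neq0.
by move=> x /= /not_implyP[_ /eqP].
Qed.

End product_null.

Lemma measurable_preimageT d1 d2 (T1 : measurableType d1)
    (T2 : measurableType d2) (f : T1 -> T2) A :
  measurable_fun setT f -> measurable A -> measurable (f @^-1` A).
Proof. by move=> mf mA; rewrite -[X in measurable X]setTI; exact: mf. Qed.

(** * Maps that pull null sets back to null sets *)

Section nonsingular.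
Context (R : realType).

(** Equivalently, the push-forward of [m1] along [f] is absolutely continuous with respect to
    [m2]. *)
Definition nonsingular d1 d2 (T1 : measurableType d1) (T2 : measurableType d2)
    (m1 : set T1 -> \bar R) (m2 : set T2 -> \bar R) (f : T1 -> T2) : Prop :=
  measurable_fun setT f /\
  forall A, measurable A -> m2 A = 0%E -> m1 (f @^-1` A) = 0%E.

Context d1 d2 d3 d4 (T1 : measurableType d1) (T2 : measurableType d2)
  (T3 : measurableType d3) (T4 : measurableType d4).

Lemma nonsingular_comp (m1 : set T1 -> \bar R) (m2 : set T2 -> \bar R)
    (m3 : set T3 -> \bar R) f g :
  nonsingular m1 m2 f -> nonsingular m2 m3 g -> nonsingular m1 m3 (g \o f).
Proof.
move=> [mf f0] [mg g0]; split; first exact: measurableT_comp.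
move=> A mA A0; rewrite comp_preimage; apply: f0; last exact: g0.
exact: measurable_preimageT.
Qed.

Lemma nonsingular_id (m1 : set T1 -> \bar R) : nonsingular m1 m1 id.
Proof. by split. Qed.

Lemma nonsingular_fst (m1 : {measure set T1 -> \bar R})
    (m2 : {sigma_finite_measure set T2 -> \bar R}) :
  nonsingular (m1 \x m2)%E m1 fst.
Proof.
split=> // A mA A0; rewrite (_ : _ @^-1` _ = A `*` setT).
  by rewrite product_measure1E// A0 mul0e.
by apply/seteqP; split=> [x /= ?|x [? _]].
Qed.

Lemma nonsingular_snd (m1 : {measure set T1 -> \bar R})
    (m2 : {sigma_finite_measure set T2 -> \bar R}) :
  nonsingular (m1 \x m2)%E m2 snd.
Proof.
split=> // A mA A0; rewrite (_ : _ @^-1` _ = setT `*` A).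
  by rewrite product_measure1E// A0 mule0.
by apply/seteqP; split=> [x /= ?|x [? ?]].
Qed.

(** The section at x of the preimage of [A] is the [g]-preimage of the section of [A] at [f x].
    Hence the points x whose section is not null lie in the [f]-preimage of the corresponding set
    for [A], which is null by Tonelli. *)
Lemma nonsingular_prod (m1 : {measure set T1 -> \bar R})
    (m2 : {sigma_finite_measure set T2 -> \bar R})
    (m3 : {measure set T3 -> \bar R})
    (m4 : {sigma_finite_measure set T4 -> \bar R}) f g :
  nonsingular m1 m3 f -> nonsingular m2 m4 g ->
  nonsingular (m1 \x m2)%E (m3 \x m4)%E (fun p => (f p.1, g p.2)).
Proof.
move=> [mf f0] [mg g0].
have mfg : measurable_fun setT (fun p : T1 * T2 => (f p.1, g p.2)).
  apply/measurable_fun_pairP; split.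
    exact: (measurableT_comp mf measurable_fst).
  exact: (measurableT_comp mg measurable_snd).
split=> // A mA /product_null_setP-/(_ mA) A0.
apply/product_null_setP; first exact: measurable_preimageT.
have xE x : xsection ((fun p : T1 * T2 => (f p.1, g p.2)) @^-1` A) x =
    g @^-1` xsection A (f x).
  by apply/seteqP; split=> y; rewrite /xsection/= !inE.
apply: measure_eq0_subset (f0 _ _ A0).
- apply: measurable_xsection_neq0; exact: measurable_preimageT.
- by apply: measurable_preimageT => //; exact: measurable_xsection_neq0.
- move=> x /=; apply: contra => /eqP Ax0; rewrite xE; apply/eqP/g0 => //.
  exact: measurable_xsection.
- exact: measurable_xsection_neq0.
Qed.

(** Applying the section criterion twice turns nullity for either bracketing into the same condition
    on iterated sections. *)
Lemma nonsingular_prodA (m1 : {measure set T1 -> \bar R})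
    (m2 : {sigma_finite_measure set T2 -> \bar R})
    (m3 : {sigma_finite_measure set T3 -> \bar R}) :
  nonsingular (m1 \x (m2 \x m3))%E ((m1 \x m2) \x m3)%E
    (fun p => ((p.1, p.2.1), p.2.2)).
Proof.
set a := fun p : T1 * (T2 * T3) => _.
have ma : measurable_fun setT a.
  apply/measurable_fun_pairP; split.
    apply/measurable_fun_pairP; split; first exact: measurable_fst.
    exact: (measurableT_comp measurable_fst measurable_snd).
  exact: (measurableT_comp measurable_snd measurable_snd).
split=> // A mA /product_null_setP-/(_ mA).
move=> /product_null_setP-/(_ (measurable_xsection_neq0 _ mA)) A0.
have maA := measurable_preimageT ma mA.
apply/(@product_null_setP _ _ _ _ _ m1 (sf_prod m2 m3)) => //.
apply: measure_eq0_subset A0.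
- exact: (@measurable_xsection_neq0 _ _ _ _ _ (sf_prod m2 m3)).
- apply: measurable_xsection_neq0; exact: measurable_xsection_neq0.
- move=> x /=; apply: contra => /eqP A0; apply/eqP.
  apply/product_null_setP; first exact: measurable_xsection.
  rewrite -[RHS]A0; congr (m2 _).
  apply/seteqP; split=> y; rewrite /xsection/= !inE/=.
    by under eq_set do rewrite inE.
  by under [X in _ -> is_true (m3 X != _)]eq_set do rewrite inE.
Qed.

End nonsingular.

(** * Nonsingular maps between powers of a measure space *)

Section tuple_nonsingular.
Context d (T : measurableType d) (R : realType).
Variable mu : {sigma_finite_measure set T -> \bar R}.

Lemma nonsingular_cons n :
  nonsingular (mu \x tuple_measure mu n)%E (tuple_measure mu n.+1)
    (fun p : T * n.-tuple T => [tuple of p.1 :: p.2]).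
Proof.
by split=> //; apply: measurable_cons; [exact: measurable_fst|exact: measurable_snd].
Qed.

(** The measure on [n.+1]-tuples is the push-forward along cons, and pulling [A] back along uncons
    and then along cons returns [A]. *)
Lemma nonsingular_uncons n :
  nonsingular (tuple_measure mu n.+1) (mu \x tuple_measure mu n)%E
    (fun t : n.+1.-tuple T => (thead t, [tuple of behead t])).
Proof.
split=> [|A mA A0].
  apply/measurable_fun_pairP; split; first exact: measurable_tnth.
  exact: measurable_behead.
rewrite -[RHS]A0 /= /pushforward; congr (product_measure1 _ _ _).
apply/seteqP; split=> -[x t] /=.
  by congr (A _); congr pair => //; exact: val_inj.
by congr (A _); congr pair => //; exact: val_inj.
Qed.

Lemma nonsingular_tnth n (i : 'I_n) :
  nonsingular (tuple_measure mu n) mu (fun t => tnth t i).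
Proof.
elim: n i => [[]//|n IH i]; case: (unliftP ord0 i) => [j|] ->.
  have := nonsingular_comp (nonsingular_comp (nonsingular_uncons n)
    (nonsingular_snd mu (tuple_measure mu n))) (IH j).
  congr nonsingular; apply/funext => t /=.
  by rewrite !(tnth_nth (thead t)) /= nth_behead.
exact: (nonsingular_comp (nonsingular_uncons n)
    (nonsingular_fst mu (tuple_measure mu n))).
Qed.

Lemma nonsingular_map_tuple n (h : T -> T) : nonsingular mu mu h ->
  nonsingular (tuple_measure mu n) (tuple_measure mu n) (map_tuple h).
Proof.
move=> nh; elim: n => [|n IH].
  rewrite (_ : map_tuple h = id); first exact: nonsingular_id.
  by apply/funext => t; rewrite tuple0 [RHS]tuple0.
have := nonsingular_comp (nonsingular_comp (nonsingular_uncons n)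
  (nonsingular_prod nh IH)) (nonsingular_cons n).
congr nonsingular; apply/funext => t /=.
by apply: val_inj; case/tupleP: t => x t /=.
Qed.

(** By induction on [k]: detach the head, split the tail, reassociate the triple product and put the
    head back on the first factor. *)
Lemma nonsingular_split_tuple k n :
  nonsingular (tuple_measure mu (k + n))
    (tuple_measure mu k \x tuple_measure mu n)%E
    (fun x => ([tuple tnth x (lshift n i) | i < k],
               [tuple tnth x (rshift k i) | i < n])).
Proof.
elim: k => [|k IH].
  rewrite (_ : (fun x => _) = (fun x : n.-tuple T => ([tuple], x))); last first.
    apply/funext => x; congr pair; first by rewrite [LHS]tuple0.
    apply: eq_from_tnth => i; rewrite tnth_mktuple; congr tnth.
    exact: val_inj.
  have mpair : measurable_fun setT (fun x : n.-tuple T => ([tuple] : 0.-tuple T, x)).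
    apply/measurable_fun_pairP.
    by split; [exact: measurable_cst|exact: measurable_id].
  split=> // A mA.
  move/(@product_null_setP _ _ _ _ _ (tuple_measure mu 0) (tuple_measure mu n)).
  move=> /(_ mA) /=; rewrite diracE.
  (* The measure on 0-tuples is a Dirac mass, so the empty tuple is not among the points with a
     non-null section: the section over it is null. *)
  case: (boolP (_ \in _)) => [_ /eqP|]; first by rewrite eqe oner_eq0.
  move=> /negP; rewrite inE /= => /negP; rewrite negbK => /eqP <- _.
  congr (tuple_measure mu n _).
  by apply/seteqP; split=> x; rewrite /xsection/= inE.
have := nonsingular_comp (nonsingular_comp (nonsingular_comp
   (nonsingular_uncons (k + n)) (nonsingular_prod (m2 := tuple_measure mu (k + n))
     (m4 := sf_prod (tuple_measure mu k) (tuple_measure mu n))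
     (nonsingular_id mu) IH))
   (nonsingular_prodA mu (tuple_measure mu k) (tuple_measure mu n)))
   (nonsingular_prod (nonsingular_cons k) (nonsingular_id (tuple_measure mu n))).
congr nonsingular; apply/funext => t; case/tupleP: t => x t /=; congr pair.
  apply: eq_from_tnth => i; case: (unliftP ord0 i) => [j|] ->.
    by rewrite tnthS [RHS]tnth_mktuple !tnth_mktuple !(tnth_nth x).
  by rewrite [RHS]tnth_mktuple !(tnth_nth x).
by apply: eq_from_tnth => i; rewrite !tnth_mktuple !(tnth_nth x).
Qed.

End tuple_nonsingular.

(** * Nonsingular maps of the real line *)

Section lipschitz_inverse.
Variable R : realType.
Implicit Types (h : R -> R) (A D : set R).

(** Fix x0 in the preimage. Any other point x of it has [h x] within b - a of [h x0], so x lies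
    within C (b - a) of x0; the preimage fits in an interval of length 2 C (b - a). *)
Lemma lebesgue_preimage_itv_le h D (C a b : R) : 0 <= C ->
  measurable_fun setT h -> measurable D ->
  (forall x y, D x -> D y -> `|x - y| <= C * `|h x - h y|) ->
  (@lebesgueR R (D `&` h @^-1` `]a, b[%classic) <=
   (2 * C)%:E * @lebesgueR R `]a, b[%classic)%E.
Proof.
move=> C0 mh mD hD; set E := D `&` _.
have [->|/set0P[x0 [Dx0]]] := eqVneq E set0.
  by rewrite measure0 mule_ge0// lee_fin mulr_ge0.
rewrite /= in_itv/= => /andP[ax0 x0b].
have ab : a < b by exact: lt_trans x0b.
apply: (@le_trans _ _ (@lebesgueR R `[x0 - C * (b - a), x0 + C * (b - a)]%classic)).
  apply: le_measure; rewrite ?inE.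
  - apply: measurableI => //; exact: measurable_preimageT (measurable_itv _).
  - exact: measurable_itv.
  - move=> x [Dx]; rewrite /= !in_itv/= => /andP[ax xb].
    rewrite -ler_distlC distrC.
    apply: le_trans (hD _ _ Dx Dx0) _; rewrite ler_wpM2l// ler_norml.
    by apply/andP; split; lra.
rewrite /lebesgueR !lebesgue_measure_itv/= !lte_fin ab -!EFinB -EFinM.
have := mulr_ge0 C0 (ltW (_ : 0 < b - a)); rewrite subr_gt0 => /(_ ab) Cab.
by case: ifP => _; rewrite lee_fin; lra.
Qed.

(** Cover [A] by open intervals of total length at most e / (2 C). By the interval estimate their
    preimages in [D] have total measure at most e. *)
Lemma lebesgue_null_preimage h D (C : R) A : 0 < C ->
  measurable_fun setT h -> measurable D ->
  (forall x y, D x -> D y -> `|x - y| <= C * `|h x - h y|) ->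
  measurable A -> @lebesgueR R A = 0%E -> @lebesgueR R (D `&` h @^-1` A) = 0%E.
Proof.
move=> C0 mh mD hD mA A0.
apply/eqP; rewrite -measure_le0; apply/lee_addgt0Pr => /= e e0; rewrite add0e.
have e'0 : 0 < e / (2 * C) by rewrite divr_gt0// mulr_gt0.
(* Lebesgue measure unfolds to this outer measure, whose description by open interval covers
   provides the cover below. *)
have oA0 : ((@wlength R idfun)^* A)%mu = 0%E by exact: A0.
have [F [AF AUF] Fe] : exists2 I_, open_itv_cover A I_ &
    (\sum_(0 <= k <oo) @wlength R idfun (I_ k) <= (e / (2 * C))%:E)%E.
  have : ((@wlength R idfun)^* A)%mu \is a fin_num by rewrite oA0.
  rewrite outer_measure_open_itv_cover.
  move=> /lb_ereal_inf_adherent-/(_ _ e'0)[_/= [F]] AF <-.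
  rewrite -outer_measure_open_itv_cover oA0 add0e => /ltW Fe.
  by exists F.
have mDF i : measurable (D `&` h @^-1` F i).
  have [[a b] ->] := AF i.
  apply: measurableI => //; exact: measurable_preimageT (measurable_itv _).
apply: (@le_trans _ _ (\sum_(0 <= k <oo) @lebesgueR R (D `&` h @^-1` F k))%E).
  apply: measure_sigma_subadditive => //.
    apply: measurableI => //; exact: measurable_preimageT.
  rewrite -setI_bigcupr -preimage_bigcup; apply: setIS; exact: preimage_subset.
have -> : e%:E = ((2 * C)%:E * (e / (2 * C))%:E)%E.
  by rewrite -EFinM; congr _%:E; field; lra.
apply: le_trans
  (_ : _ <= (2 * C)%:E * \sum_(0 <= k <oo) @wlength R idfun (F k))%E _; last first.
  by rewrite lee_pmul2l// lte_fin mulr_gt0.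
rewrite -nneseriesZl//.
apply: lee_nneseries => // i _.
have [[a b] ->] := AF i.
rewrite wlength_itv/= -(@lebesgue_measure_itv R `]a, b[).
by apply: lebesgue_preimage_itv_le => //; exact: ltW.
Qed.

(* The condition says that [h] is injective on each [D n] with a [C n]-Lipschitz
   inverse; [h] need not be injective globally. *)
Lemma nonsingular_lipschitz_inverse h (D : (set R)^nat) (C : R^nat) :
  measurable_fun setT h -> (forall n, measurable (D n)) ->
  \bigcup_n D n = setT -> (forall n, 0 < C n) ->
  (forall n x y, D n x -> D n y -> `|x - y| <= C n * `|h x - h y|) ->
  nonsingular (@lebesgueR R) (@lebesgueR R) h.
Proof.
move=> mh mD DT C0 hD; split=> // A mA A0.
rewrite -[h @^-1` A]setTI -DT setI_bigcupl.
apply: measure_bigcup_eq0 => n.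
  by apply: measurableI => //; exact: measurable_preimageT.
exact: lebesgue_null_preimage (hD n) _ _.
Qed.

Lemma nonsingular_scale (c : R) : c != 0 ->
  nonsingular (@lebesgueR R) (@lebesgueR R) ( *%R c).
Proof.
move=> c0; apply: (@nonsingular_lipschitz_inverse ( *%R c)
  (fun=> setT) (fun=> `|c|^-1)) => //.
- by apply/seteqP; split => // x _; exists 0%N.
- by move=> _; rewrite invr_gt0 normr_gt0.
- by move=> _ x y _ _; rewrite -mulrBr normrM mulKf// normr_eq0.
Qed.

(** The chart measure lives on all of R^n, not only over the polytope. [Num.sqrt] alone would send
    the whole negative half-line to 0 and so fail to be nonsingular; the absolute value prevents
    this. *)
Definition sqrt_abs (x : R) : R := Num.sqrt `|x|.

Lemma measurable_sqrt_abs : measurable_fun setT sqrt_abs.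
Proof.
have -> : sqrt_abs = (@powR R ^~ 2^-1) \o (fun x => `|x|).
  by apply/funext => x /=; rewrite powR12_sqrt.
exact: (@measurableT_comp _ _ _ _ _ _ (@powR R ^~ 2^-1)).
Qed.

(** For x and y of the same sign, |x - y| is the difference of the square roots times their sum, and
    the sum is at most 2 sqrt K. The summand 1 keeps the constant positive when K = 0. *)
Lemma sqrt_abs_lipschitz_inverse (K x y : R) : `|x| <= K -> `|y| <= K ->
  (0 <= x /\ 0 <= y) \/ (x < 0 /\ y < 0) ->
  `|x - y| <= (2 * Num.sqrt K + 1) * `|sqrt_abs x - sqrt_abs y|.
Proof.
move=> xK yK xy.
have K0 : 0 <= K by apply: le_trans xK.
have -> : `|x - y| = `| `|x| - `|y| |.
  case: xy => -[x0 y0]; first by rewrite (ger0_norm x0) (ger0_norm y0).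
  by rewrite (ltr0_norm x0) (ltr0_norm y0) -opprD normrN.
rewrite -{1}(sqr_sqrtr (normr_ge0 x)) -{1}(sqr_sqrtr (normr_ge0 y)) subr_sqr.
rewrite normrM mulrC ler_wpM2r// ger0_norm ?addr_ge0 ?sqrtr_ge0//.
have : Num.sqrt `|x| <= Num.sqrt K by rewrite ler_sqrt.
have : Num.sqrt `|y| <= Num.sqrt K by rewrite ler_sqrt.
lra.
Qed.

Lemma nonsingular_sqrt_abs :
  nonsingular (@lebesgueR R) (@lebesgueR R) sqrt_abs.
Proof.
(* Odd indices exhaust the nonnegative half-line and even ones the negative half-line; [sqrt_abs] is
   injective on each piece. *)
pose D n : set R := if odd n then `[0, n%:R]%classic else `[- n%:R, 0[%classic.
apply: (@nonsingular_lipschitz_inverse _ D (fun n => 2 * Num.sqrt n%:R + 1)).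
- exact: measurable_sqrt_abs.
- by move=> n; rewrite /D; case: ifP => _; exact: measurable_itv.
- apply/seteqP; split=> // x _.
  have [m xm] : exists m : nat, `|x| < m%:R.
    by exists (Num.bound `|x|); exact: archi_boundP.
  have m2 : `|x| <= m.*2%:R.
    by apply: le_trans (ltW xm) _; rewrite ler_nat -addnn leq_addr.
  have m3 : `|x| <= m.*2.+1%:R by apply: le_trans m2 _; rewrite ler_nat.
  move: m2 m3; rewrite !ler_norml => /andP[m2 m2'] /andP[m3 m3'].
  have [x0|x0] := leP 0 x.
    by exists m.*2.+1 => //; rewrite /D /= odd_double/= in_itv/= x0.
  by exists m.*2 => //; rewrite /D /= odd_double/= in_itv/= x0 m2.
- by move=> n; rewrite ltr_pwDr// mulr_ge0// sqrtr_ge0.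
- move=> n x y; rewrite /D.
  case: ifP => _; rewrite /= !in_itv/= => /andP[x1 x2] /andP[y1 y2].
    by apply: sqrt_abs_lipschitz_inverse; rewrite ?ger0_norm//; left.
  by apply: sqrt_abs_lipschitz_inverse; rewrite ?ltr0_norm// 1?lerNl//; right.
Qed.

End lipschitz_inverse.
Arguments sqrt_abs {R} x.

(** * Directions of vectors and of their blocks *)

Section directions.
Variable R : realType.

Lemma euclid_norm_ge0 k (x : k.-tuple R) : 0 <= euclid_norm x.
Proof. exact: sqrtr_ge0. Qed.

Lemma euclid_norm_eq0 k (x : k.-tuple R) (i : 'I_k) :
  euclid_norm x = 0 -> tnth x i = 0.
Proof.
move=> /eqP; rewrite sqrtr_eq0 => x0.
have : \sum_(i < k) tnth x i ^+ 2 == 0.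
  by rewrite eq_le x0/= sumr_ge0// => j _; exact: sqr_ge0.
rewrite psumr_eq0 => [/allP/(_ i)|j _]; last exact: sqr_ge0.
by rewrite mem_index_enum/= sqrf_eq0 => /(_ isT)/eqP.
Qed.

Lemma euclid_norm_scale k (c : R) (x y : k.-tuple R) : 0 <= c ->
  (forall i, tnth x i = c * tnth y i) -> euclid_norm x = c * euclid_norm y.
Proof.
move=> c0 xy; rewrite /euclid_norm; under eq_bigr do rewrite xy exprMn.
by rewrite -mulr_sumr sqrtrM ?sqr_ge0// sqrtr_sqr ger0_norm.
Qed.

Lemma normalize_scale k (c : R) (x y : k.-tuple R) : 0 < c ->
  (forall i, tnth x i = c * tnth y i) -> normalize x = normalize y.
Proof.
move=> c0 xy; apply: eq_from_tnth => i; rewrite !tnth_mktuple xy.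
by rewrite (euclid_norm_scale (ltW c0) xy) -mulf_div divff ?mul1r// gt_eqF.
Qed.

Lemma sphere_plus_normalize k (x : k.-tuple R) :
  (forall i, 0 <= tnth x i) -> euclid_norm x != 0 -> sphere_plus (normalize x).
Proof.
move=> x0 nx0; have nx_ge0 := euclid_norm_ge0 x; split=> [|i].
  rewrite (@euclid_norm_scale _ (euclid_norm x)^-1 _ x) ?mulVf// ?invr_ge0//.
  by move=> i; rewrite tnth_mktuple mulrC.
by rewrite tnth_mktuple divr_ge0.
Qed.

Lemma measurable_sphere_plus k : measurable (@sphere_plus R k).
Proof.
have -> : @sphere_plus R k = @euclid_norm R k @^-1` [set 1] `&`
    \bigcap_(i in [set: 'I_k]) ((fun x => tnth x i) @^-1` `[0, +oo[%classic).
  apply/seteqP; split=> x /= [x1 x0]; split=> // i.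
    by move=> _; rewrite /= in_itv/= andbT.
  by have := x0 i I; rewrite /= in_itv/= andbT.
apply: measurableI.
  exact: measurable_preimageT (@measurable_euclid_norm R k) (measurable_set1 _).
apply: fin_bigcap_measurable => // i _.
exact: measurable_preimageT (measurable_tnth i) (measurable_itv _).
Qed.

Lemma measurable_punctured_ball k : measurable (@punctured_ball R k).
Proof.
have -> : @punctured_ball R k = @euclid_norm R k @^-1` `]0, 1]%classic.
  by apply/seteqP; split=> x /=; rewrite in_itv.
exact: measurable_preimageT (@measurable_euclid_norm R k) (measurable_itv _).
Qed.

(** A point of the cone [B] of norm less than m enters the unit ball after division by m + 1. So [B]
    is covered by countably many preimages, under nonsingular dilations, of its null part in the
    ball. *)
Lemma lebesgue_cone_eq0 k (B : set (k.-tuple R)) : measurable B ->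
  (forall x, B x -> 0 < euclid_norm x) ->
  (forall c x, 0 < c -> B x -> B (map_tuple ( *%R c) x)) ->
  @lebesgue_tuple R k (B `&` @punctured_ball R k) = 0%E ->
  @lebesgue_tuple R k B = 0%E.
Proof.
move=> mB B0 Bc Bball0.
have mBb : measurable (B `&` @punctured_ball R k).
  by apply: measurableI => //; exact: measurable_punctured_ball.
have ns (m : nat) : nonsingular (@lebesgue_tuple R k) (@lebesgue_tuple R k)
    (map_tuple ( *%R m.+1%:R^-1)).
  by apply: nonsingular_map_tuple; apply: nonsingular_scale; rewrite invr_eq0.
apply: (@measure_eq0_subset _ _ _ (@lebesgue_tuple R k) _ (\bigcup_m
    ((map_tuple ( *%R m.+1%:R^-1)) @^-1` (B `&` @punctured_ball R k)))) => //.
- by apply: bigcup_measurable => m _; exact: measurable_preimageT (ns m).1 mBb.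
- move=> x Bx.
  have [m xm] : exists m : nat, euclid_norm x < m%:R.
    exists (Num.bound (euclid_norm x)); apply: archi_boundP.
    exact: euclid_norm_ge0.
  exists m => //; split; first by apply: Bc => //; rewrite invr_gt0.
  rewrite /punctured_ball /= (@euclid_norm_scale _ m.+1%:R^-1 _ x).
  + by rewrite mulr_gt0 ?invr_gt0 ?B0//= ler_pdivrMl// mulr1
      (le_trans (ltW xm))// ler_nat.
  + by rewrite invr_ge0.
  + by move=> i; rewrite tnth_map.
- apply: measure_bigcup_eq0 => m; first exact: measurable_preimageT (ns m).1 mBb.
  exact: (ns m).2.
Qed.

Lemma lebesgue_tuple_coord_eq0 k (i : 'I_k) :
  measurable [set x : k.-tuple R | tnth x i = 0] /\
  @lebesgue_tuple R k [set x | tnth x i = 0] = 0%E.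
Proof.
have [mt t0] := nonsingular_tnth (@lebesgueR R) i; split.
  exact: measurable_preimageT mt (measurable_set1 0).
by apply: (t0 [set 0]) => //; exact: lebesgue_measure_set1.
Qed.

(** A null set of the sphere spans a cone that is null in the ball, hence null altogether, and the
    coordinatewise [sqrt_abs] pulls it back to a null set. The vectors without a direction are
    absorbed by a coordinate hyperplane. *)
Lemma nonsingular_sqrt_direction k : (0 < k)%N ->
  nonsingular (@lebesgue_tuple R k) (@sphere_plus_measure R k)
    (@normalize R k \o map_tuple sqrt_abs).
Proof.
move=> k0; have [mh h0] := nonsingular_map_tuple k (@nonsingular_sqrt_abs R).
have mn := @measurable_normalize R k.
have mnh := measurableT_comp mn mh.
split=> // A mA A0; set B := @normalize R k @^-1` (A `&` @sphere_plus R k).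
have mAS : measurable (A `&` @sphere_plus R k).
  by apply: measurableI => //; exact: measurable_sphere_plus.
have mB : measurable B by exact: measurable_preimageT.
have B0 : @lebesgue_tuple R k B = 0%E.
  apply: lebesgue_cone_eq0 => //.
  (* As division by 0 gives 0, a vector of norm 0 normalizes to 0, which is not on the sphere. *)
  - move=> x [_ [x1 _]]; rewrite lt_neqAle euclid_norm_ge0 andbT eq_sym.
    apply/eqP => x0; move: x1 => /eqP; rewrite /euclid_norm big1.
      by rewrite sqrtr0 eq_sym oner_eq0.
    by move=> i _; rewrite tnth_mktuple x0 invr0 mulr0 expr0n.
  - move=> c x c0; rewrite /B /= (@normalize_scale _ c _ x)//.
    by move=> i; rewrite tnth_map.
  (* The surface measure is k times the measure of the cone in the ball, and k is nonzero. *)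
  - move: A0; rewrite /sphere_plus_measure /sphere_measure => /eqP.
    by rewrite mule_eq0 eqe pnatr_eq0 -leqn0 leqNgt k0/= => /eqP.
have [mZ Z0] := lebesgue_tuple_coord_eq0 (Ordinal k0).
have mhB : measurable (map_tuple sqrt_abs @^-1` B) by exact: measurable_preimageT.
apply: (@measure_eq0_subset _ _ _ (@lebesgue_tuple R k) _
    (map_tuple sqrt_abs @^-1` B `|` [set x | tnth x (Ordinal k0) = 0])).
- exact: measurable_preimageT.
- exact: measurableU.
- move=> x Ax; have [x0|x0] := eqVneq (euclid_norm (map_tuple sqrt_abs x)) 0.
    right; have := euclid_norm_eq0 (Ordinal k0) x0.
    by rewrite tnth_map => /eqP; rewrite sqrtr_eq0 normr_le0 => /eqP.
  left; split => //; apply: sphere_plus_normalize => // i.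
  by rewrite tnth_map sqrtr_ge0.
- by apply: measure_setU_eq0 => //; exact: h0.
Qed.

(** A real counterpart of [spherical_blocks], so that the moduli of w and the square roots of its
    moment coordinates pass through the same function. *)
Fixpoint block_directions (k : seq nat) (x : seq R) : blocks R k :=
  match k return blocks R k with
  | [::] => tt
  | k1 :: k' => (normalize [tuple x`_i | i < k1],
                 block_directions k' (drop k1 x))
  end.

Lemma spherical_blocksE k (v : seq R[i]) :
  spherical_blocks k v = block_directions k (map (@normc R) v).
Proof.
elim: k v => //= k1 k IH v; rewrite IH map_drop; congr pair; congr normalize.
apply: eq_from_tnth => i; rewrite !tnth_mktuple.
have [iv|iv] := ltnP i (size v); first by rewrite (nth_map 0).
by rewrite !nth_default ?size_map// normc0.
Qed.

Lemma block_directions_scale k (c : R) (x y : seq R) : 0 < c ->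
  (forall i, x`_i = c * y`_i) -> block_directions k x = block_directions k y.
Proof.
move=> c0; elim: k x y => //= k1 k IH x y xy; congr pair.
  by apply: (normalize_scale c0) => i; rewrite !tnth_mktuple.
by apply: IH => i; rewrite !nth_drop.
Qed.

(** As every block has at least one entry, positive entries make each block nonzero, and its
    normalization is then a genuine point of the sphere. *)
Lemma spheres_plus_block_directions k (x : seq R) : all (leq 1) k ->
  (forall i, (i < sumn k)%N -> 0 < x`_i) ->
  spheres_plus (block_directions k x).
Proof.
elim: k x => //= k1 k IH x /andP[k1_gt0 k_gt0] x0; split => /=.
  apply: sphere_plus_normalize => [i|].
    by rewrite tnth_mktuple ltW// x0// ltn_addr.
  apply/eqP => /(euclid_norm_eq0 (Ordinal k1_gt0)); rewrite tnth_mktuple => x00.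
  by have := x0 0%N; rewrite addn_gt0 k1_gt0 x00 ltxx => /(_ isT).
by apply: IH => // i ik; rewrite nth_drop x0// ltn_add2l.
Qed.

Lemma measurable_spheres_plus k : measurable (@spheres_plus R k).
Proof.
elim: k => [|k1 k IH] /=; first exact: measurableT.
by apply: measurableX => //; exact: measurable_sphere_plus.
Qed.

(** By induction on [k]: split off the first block, then take the product of its direction map with
    the map for the remaining blocks. *)
Lemma nonsingular_block_directions k n : all (leq 1) k -> sumn k = n ->
  nonsingular (@lebesgue_tuple R n) (@spheres_plus_measure R k)
    (fun x : n.-tuple R => block_directions k (map sqrt_abs x)).
Proof.
move=> + <- {n}; elim: k => [_|k1 k IH /= /andP[k1_gt0 /IH{}IH]] /=.
  split; first exact: measurable_cst.
  by move=> A mA; rewrite /lebesgue_tuple /= !diracE.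
have := nonsingular_comp (nonsingular_split_tuple (@lebesgueR R) k1 (sumn k))
  (nonsingular_prod (m2 := @lebesgue_tuple R (sumn k))
    (m4 := @spheres_plus_measure R k) (nonsingular_sqrt_direction k1_gt0) IH).
congr nonsingular; apply/funext => x /=; congr pair.
  congr normalize; apply: eq_from_tnth => i; rewrite tnth_map !tnth_mktuple.
  rewrite (nth_map 0) ?size_tuple ?ltn_addr// (tnth_nth 0)//.
congr block_directions; rewrite -map_drop; congr map.
apply: (@eq_from_nth _ 0).
  by rewrite size_map size_enum_ord size_drop size_tuple addKn.
move=> i; rewrite size_map size_enum_ord => ik.
rewrite (nth_map (Ordinal ik)) ?size_enum_ord// (tnth_nth 0) nth_drop /=.
by rewrite nth_enum_ord.
Qed.

End directions.

(** * The coordinate hyperplanes are null in projective space *)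

Section fubini_study_null.
Variables (R : realType) (n : nat).
Local Notation vec := (n.+1.-tuple R[i]).

Lemma complex_lebesgue_set1_0 :
  measurable [set 0 : R[i]] /\ @complex_lebesgue R [set 0] = 0%E.
Proof.
have E : @complex_of_pair R @^-1` [set 0] = [set 0] `*` [set 0].
  apply/seteqP; split=> -[x y] /=; first by case=> -> ->.
  by case=> /= -> ->.
split.
  rewrite /measurable /= /image_measurable /image_set_system /= setTI E.
  exact: measurableX.
rewrite /complex_lebesgue /pushforward E.
rewrite (product_measure1E (@lebesgueR R) (@lebesgueR R))//.
by rewrite [X in (X * _)%E]lebesgue_measure_set1 mul0e.
Qed.

Lemma complex_tuple_coord_eq0 (i : 'I_n.+1) :
  measurable [set w : vec | tnth w i = 0] /\
  @lebesgue_complex_tuple R n [set w | tnth w i = 0] = 0%E.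
Proof.
have [mt t0] := nonsingular_tnth (@complex_lebesgue R) i.
have [m0 l0] := complex_lebesgue_set1_0; split.
  exact: measurable_preimageT mt m0.
exact: (t0 [set 0]).
Qed.

Lemma measurable_punctured_hball : measurable (@punctured_hball R n).
Proof.
have mh : measurable_fun [set: vec] (@hermitian_norm R n).
  have -> : @hermitian_norm R n = @euclid_norm R n.+1 \o map_tuple (@normc R).
    by apply/funext => w /=; congr Num.sqrt; apply: eq_bigr => i _; rewrite tnth_map.
  apply: measurableT_comp; first exact: measurable_euclid_norm.
  apply/measurable_fun_tnthP => i.
  have -> : (@tnth _ _)^~ i \o map_tuple (@normc R) =
      @normc R \o (@tnth n.+1 R[i])^~ i.
    by apply/funext => w /=; rewrite tnth_map.
  apply: measurableT_comp; first exact: measurable_normc.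
  exact: measurable_tnth.
have -> : @punctured_hball R n = @hermitian_norm R n @^-1` `]0, 1]%classic.
  by apply/seteqP; split=> x /=; rewrite in_itv.
exact: measurable_preimageT mh (measurable_itv _).
Qed.

(** The exceptional set of the final argument. Representatives of a point differ by a nonzero
    scalar, so the choice made by [repr] does not affect it. *)
Definition vanishing_coord : set (proj_space R n) :=
  [set p | exists i, tnth (val (repr p)) i = 0].

(** The zero vector must be removed because [proj_class] sends it to [1 : ... : 1], which has no
    zero coordinate. The union runs over [nat], and [inord] reaches every index. *)
Lemma preimage_vanishing_coord :
  @proj_class R n @^-1` vanishing_coord =
  (\bigcup_i [set w : vec | tnth w (inord i) = 0]) `\` [set [tuple 0 | _ < n.+1]].
Proof.
apply/seteqP; split=> w.
  have [->|w0] := eqVneq w [tuple 0 | _ < n.+1]; move=> [j].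
    have -> : proj_class [tuple (0 : R[i]) | _ < n.+1] =
        proj_class [tuple 1 | _ < n.+1].
      congr (\pi_(proj_space R n))%qT.
      rewrite (_ : [tuple 1 | _ < n.+1] = val (ones R n))// valKd.
      by rewrite /insubd insubN// eqxx.
    have [c c0 ->] := proj_classP (ones_neq0 R n).
    by rewrite tnth_mktuple mulr1 => /eqP; rewrite (negPf c0).
  have [c c0 ->] := proj_classP w0.
  move=> /eqP; rewrite mulf_eq0 (negPf c0)/= => /eqP wi0.
  by split; [exists j => //=; rewrite inord_val|exact/eqP].
move=> [[i _] /= wi0 /eqP w0]; exists (inord i).
by have [c c0 ->] := proj_classP w0; rewrite wi0 mulr0.
Qed.

Lemma measurable_preimage_vanishing_coord :
  measurable (@proj_class R n @^-1` vanishing_coord).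
Proof.
rewrite preimage_vanishing_coord; apply: measurableD.
  by apply: bigcup_measurable => i _; exact: (complex_tuple_coord_eq0 _).1.
have -> : [set [tuple (0 : R[i]) | _ < n.+1]] =
    \bigcap_(i in [set: 'I_n.+1]) [set w : vec | tnth w i = 0].
  apply/seteqP; split=> w /=; first by move=> -> i _ /=; rewrite tnth_mktuple.
  by move=> w0; apply: eq_from_tnth => i; rewrite tnth_mktuple w0.
apply: fin_bigcap_measurable => // i _; exact: (complex_tuple_coord_eq0 _).1.
Qed.

(** The preimage in C^{n+1} lies in a countable union of hyperplanes w_i = 0, each null as the
    pullback of {0} along a coordinate. *)
Lemma fubini_study_vanishing_coord :
  measurable vanishing_coord /\ @fubini_study R n vanishing_coord = 0%E.
Proof.
have mV := measurable_preimage_vanishing_coord; split.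
  by rewrite /measurable /= /image_measurable /image_set_system /= setTI.
rewrite /fubini_study /lebesgue_complex_tuple.
rewrite (@measure_eq0_subset _ _ _ (tuple_measure (@complex_lebesgue R) n.+1) _
  (\bigcup_i [set w : vec | tnth w (inord i) = 0])) ?mule0//.
- by apply: measurableI => //; exact: measurable_punctured_hball.
- by apply: bigcup_measurable => i _; exact: (complex_tuple_coord_eq0 _).1.
- by rewrite preimage_vanishing_coord => w [[]].
- by apply: measure_bigcup_eq0 => i; have [] := complex_tuple_coord_eq0 (inord i).
Qed.

End fubini_study_null.

(** * Factorization of the spherical coordinates through the moment map *)

Section moment_directions.
Variables (R : realType) (n : nat).

(** With N the norm of w, the square root of |w_i|^2 / (2 N^2) times that of 2 N^2 is |w_i|, and a
    common positive factor leaves directions unchanged. The equality holds at every point, since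
    zero blocks normalize to 0 on both sides. *)
Lemma spherical_coords_moment_map k (p : proj_space R n) :
  spherical_coords k p =
  block_directions k (map (@sqrt_abs R) (behead (moment_map p))).
Proof.
rewrite /spherical_coords spherical_blocksE /moment_map.
move: (val (repr p)) (valP (repr p)) => w w0; set N := hermitian_norm w.
have N0 : 0 < N.
  rewrite lt_neqAle sqrtr_ge0 andbT eq_sym; apply: contra w0 => /eqP Nw.
  apply/eqP/eq_from_tnth => i; rewrite tnth_mktuple; apply: eq0_normc.
  have := @euclid_norm_eq0 _ _ (map_tuple (@normc R) w) i; rewrite tnth_map; apply.
  by rewrite -[RHS]Nw; congr Num.sqrt; apply: eq_bigr => j _; rewrite tnth_map.
have c0 : 0 < 2 * N ^+ 2 by rewrite mulr_gt0// exprn_gt0.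
apply: (@block_directions_scale _ _ (Num.sqrt (2 * N ^+ 2))).
  by rewrite sqrtr_gt0.
(* Entry i of the beheaded vector is coordinate i + 1 of w; past the end both sequences return the
   default 0. *)
move=> i; have [iw|iw] := ltnP i n; last first.
  by rewrite !nth_default ?mulr0// size_map size_behead size_tuple.
rewrite !(nth_map 0) ?size_behead ?size_tuple// !nth_behead.
rewrite -!(tnth_nth 0 _ (Ordinal (iw : i.+1 < n.+1)%N)) tnth_mktuple /sqrt_abs.
have nc0 : 0 <= normc (tnth w (Ordinal (iw : (i.+1 < n.+1)%N))).
  by case: (tnth _ _) => a b; exact: sqrtr_ge0.
rewrite ger0_norm; last by rewrite divr_ge0 ?sqr_ge0// ltW.
by rewrite -sqrtrM ?ltW// mulrCA divff ?gt_eqF// mulr1 sqrtr_sqr ger0_norm.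
Qed.

Lemma spheres_plus_spherical_coords k (p : proj_space R n) :
  all (leq 1) k -> sumn k = n -> ~ vanishing_coord p ->
  spheres_plus (spherical_coords k p).
Proof.
move=> k_gt0 kn p0; rewrite /spherical_coords spherical_blocksE.
apply: spheres_plus_block_directions => // i; rewrite kn => iltn.
rewrite (nth_map 0) ?size_behead ?size_tuple// nth_behead.
rewrite -(tnth_nth 0 _ (Ordinal (iltn : (i.+1 < n.+1)%N))).
rewrite lt_neqAle eq_sym; apply/andP; split; last first.
  by case: (tnth _ _) => a b; exact: sqrtr_ge0.
by apply/eqP => /eq0_normc wi0; apply: p0; eexists; exact: wi0.
Qed.

End moment_directions.

(** * The inclusion of the two families of symbols *)

Lemma ae_class_eq d (T : measurableType d) (R : realType)
    (mu : {measure set T -> \bar R}) (f g : T -> R[i]) :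
  {ae mu, forall x, f x = g x} -> ae_class mu f = ae_class mu g.
Proof.
move=> fg; apply/seteqP; split=> h hE; rewrite /ae_class /=.
  by apply: filterS2 hE fg => x -> ->.
by apply: filterS2 hE fg => x -> ->.
Qed.

Theorem theorem5p6 (R : realType) (n l : nat) (k : l.-tuple nat)
    (hn : (1 <= n)%N) (hl : (1 <= l)%N) (hk : is_partition n k) :
  [set ae_class (@fubini_study R n) (b \o @spherical_coords R n k) |
    b in Linfty (@spheres_plus_measure R k) (@spheres_plus R k)] `<=`
  [set ae_class (@fubini_study R n) (f \o @moment_map R n) |
    f in Linfty (@hyperplane_measure R n) (@polytope R n)].
Proof.
have k_gt0 : all (leq 1) k.
  by apply/allP => m /tnthP[j ->]; exact: hk.1.
have kn : sumn k = n by rewrite sumnE big_tuple; exact: hk.2.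
move=> _ [b [mb [M bM]] <-].
have mS := @measurable_spheres_plus R k.
have [mD D0] := nonsingular_block_directions R k_gt0 kn.
pose G (x : n.+1.-tuple R) : blocks R k :=
  block_directions k (map (@sqrt_abs R) (behead x)).
have mG : measurable_fun setT G.
  exact: (measurableT_comp mD (@measurable_behead _ _ n)).
(* [b] is measurable only on the product of spheres, whereas [G] may leave it where a block
   vanishes; extending [b] by 0 gives a measurable function on all blocks. *)
exists ((b \_ (@spheres_plus R k)) \o G).
  split.
    apply: measurable_funTS; apply: (measurableT_comp _ mG).
    exact/(measurable_restrictT _ mS).
  (* The maximum with 0 also bounds the values of the zero extension when M is negative. The
     exceptional set is the [G]-preimage of the one for [b]. *)
  exists (Num.max M 0); case: bM => N [mN N0 bN]; exists (G @^-1` N); split.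
  - exact: measurable_preimageT.
  - rewrite /hyperplane_measure.
    (* [G] drops the coordinate x_0 that the chart adds, so composing them leaves the nonsingular
       map on R^n. *)
    have -> : @hyperplane_chart R n @^-1` (G @^-1` N) =
        (fun x : n.-tuple R => block_directions k (map (@sqrt_abs R) x)) @^-1` N.
      by [].
    by rewrite D0 ?mule0.
  - move=> x /= /not_implyP[_ GM]; apply: bN => /= bM; apply: GM.
    rewrite /patch; case: ifPn => [/set_mem Sx|_].
      by rewrite le_max bM.
    by rewrite normc0 le_max lexx orbT.
apply: ae_class_eq.
have [mV V0] := fubini_study_vanishing_coord R n.
(* Off this null set the spherical coordinates lie in the product of spheres, where the zero
   extension agrees with [b]. *)
exists (@vanishing_coord R n); split => // p /= bp; apply: contrapT => pV.
apply: bp; rewrite /= /G -spherical_coords_moment_map patchE mem_set//.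
exact: spheres_plus_spherical_coords.
Qed.
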